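(* For $k\ge1$ and $n\ge0$, \[ M_{k-1,n}=\frac{1}{n+1}\sum_{0\le j\le n/k}(-1)^j\binom{n+1}{j}\binom{2n-jk}{n}. \] For $k,n\ge1$, \[ C_{k,n}=\sum_{0\le j\le (n-1)/k}\frac{(-1)^j}{n}\binom{n}{j}\binom{2n-jk}{n+1}. \]
   Context: A plane tree is a rooted tree with linearly ordered children; the degree of a node is its number of children. For $k\ge0$, $M_{k,n}$ is the number of plane trees with $n+1$ nodes in which every node has degree at most $k$. For $k\ge1$, $C_{k,n}$ is the modular Catalan number: the number of classes of binary trees with $n+1$ leaves under the equivalence generated by $k$-rotations, where binary trees have every node with $0$ or $2$ ordered children, $s\wedge t$ has left subtree $s$ and right subtree $t$ (iterated $\wedge$ read left to right), and a $k$-rotation replaces a maximal subtree $(t_0\wedge\cdots\wedge t_k)\wedge t_{k+1}$ by $t_0\wedge(t_1\wedge\cdots\wedge t_{k+1})$ or vice versa. *)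

(* Defs.v *)
From Stdlib Require Import Relation_Operators.
From HB Require Import structures.
From mathcomp Require Import all_boot all_order all_algebra.
From mathcomp Require Import boolp.

Set Implicit Arguments.
Unset Strict Implicit.
Unset Printing Implicit Defensive.

Inductive plane_tree := PNode of seq plane_tree.

Fixpoint nodes (t : plane_tree) : nat :=
  let: PNode ts := t in (sumn (map nodes ts)).+1.

Fixpoint degrees_le (k : nat) (t : plane_tree) : bool :=
  let: PNode ts := t in (size ts <= k) && all (degrees_le k) ts.

Inductive bintree := BLeaf | BNode of bintree & bintree.

Fixpoint leaves (t : bintree) : nat :=
  if t is BNode l r then leaves l + leaves r else 1.

(* comb t [:: t1; ...; tm] is t /\ t1 /\ ... /\ tm, associated to the left. *)
Definition comb (t : bintree) (ts : seq bintree) : bintree := foldl BNode t ts.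

(* One k-rotation, from left to right, of the subtree rooted at some node.
   In krot_root, [:: t1 & ts] lists t_1, ..., t_k and u is t_{k+1}. *)
Inductive krotation (k : nat) : bintree -> bintree -> Prop :=
| krot_root (t0 t1 : bintree) (ts : seq bintree) (u : bintree) :
    size (t1 :: ts) = k ->
    krotation k (BNode (comb t0 (t1 :: ts)) u)
                (BNode t0 (comb t1 (rcons ts u)))
| krot_left (s s' t : bintree) :
    krotation k s s' -> krotation k (BNode s t) (BNode s' t)
| krot_right (s t t' : bintree) :
    krotation k t t' -> krotation k (BNode s t) (BNode s t').

Definition krot_equiv (k : nat) : bintree -> bintree -> Prop :=
  clos_refl_sym_trans bintree (krotation k).

Fixpoint bintree_encode (t : bintree) : GenTree.tree unit :=
  if t is BNode l r then GenTree.Node 0 [:: bintree_encode l; bintree_encode r]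
  else GenTree.Leaf tt.

Fixpoint bintree_decode (t : GenTree.tree unit) : bintree :=
  if t is GenTree.Node _ [:: l; r] then BNode (bintree_decode l) (bintree_decode r)
  else BLeaf.

Lemma bintree_encodeK : cancel bintree_encode bintree_decode.
Proof. by elim=> //= l -> r ->. Qed.

HB.instance Definition _ := Countable.copy bintree (can_type bintree_encodeK).

Fixpoint plane_tree_encode (t : plane_tree) : GenTree.tree unit :=
  let: PNode ts := t in GenTree.Node 0 (map plane_tree_encode ts).

Fixpoint plane_tree_decode (t : GenTree.tree unit) : plane_tree :=
  if t is GenTree.Node _ ts then PNode (map plane_tree_decode ts)
  else PNode [::].

Lemma plane_tree_encodeK : cancel plane_tree_encode plane_tree_decode.
Proof.
rewrite /cancel; fix IH 1; case=> ts /=; congr PNode.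
by elim: ts => //= t ts ->; rewrite IH.
Qed.

HB.instance Definition _ :=
  Countable.copy plane_tree (can_type plane_tree_encodeK).

Lemma insub_enumP (T : countType) (P : pred T) (e : seq T) :
  (forall x, P x -> x \in e) ->
  Finite.axiom (pmap insub (undup e) : seq {x | P x}).
Proof.
move=> eP; apply: Finite.uniq_enumP => [|x].
  by apply: pmap_sub_uniq; exact: undup_uniq.
by rewrite mem_pmap_sub mem_undup eP // (valP x).
Qed.

Fixpoint bintree_enum (h : nat) : seq bintree :=
  if h is h'.+1 then
    BLeaf :: [seq BNode l r | l <- bintree_enum h', r <- bintree_enum h']
  else [::].

Lemma leaves_gt0 t : 0 < leaves t.
Proof. by elim: t => //= l lgt0 r _; rewrite addn_gt0 lgt0. Qed.

Lemma bintree_enumP h t : leaves t <= h -> t \in bintree_enum h.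
Proof.
elim: h t => [|h IH] [|l r] //=; first by rewrite leqNgt addn_gt0 leaves_gt0.
move=> le_lr; rewrite inE /=; apply/allpairsP; exists (l, r); split=> //=;
  apply: IH; rewrite -ltnS; apply: leq_trans le_lr.
  by rewrite -addn1 leq_add2l leaves_gt0.
by rewrite -add1n leq_add2r leaves_gt0.
Qed.

Definition bintree_of (n : nat) := {t : bintree | leaves t == n.+1}.

HB.instance Definition _ n := Countable.on (bintree_of n).

Lemma bintree_of_enumP n :
  Finite.axiom (pmap insub (undup (bintree_enum n.+1)) : seq (bintree_of n)).
Proof.
by apply: insub_enumP => t /eqP eq_t; apply: bintree_enumP; rewrite eq_t.
Qed.

HB.instance Definition _ n := isFinite.Build (bintree_of n) (@bintree_of_enumP n).

Fixpoint seqs_le (T : Type) (m : nat) (e : seq T) : seq (seq T) :=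
  if m is m'.+1 then [::] :: [seq x :: s | x <- e, s <- seqs_le m' e]
  else [:: [::]].

Lemma seqs_leP (T : eqType) m (e s : seq T) :
  size s <= m -> {subset s <= e} -> s \in seqs_le m e.
Proof.
elim: m s => [|m IH] [|x s] //= le_s sub_s.
rewrite inE /=; apply/allpairsP; exists (x, s); split=> //=.
  by apply: sub_s; rewrite mem_head.
by apply: IH => // y ys; apply: sub_s; rewrite inE ys orbT.
Qed.

Fixpoint plane_tree_enum (h : nat) : seq plane_tree :=
  if h is h'.+1 then map PNode (seqs_le h' (plane_tree_enum h')) else [::].

Lemma plane_tree_enumP h t : nodes t <= h -> t \in plane_tree_enum h.
Proof.
elim: h t => [|h IH] [ts] //=; rewrite ltnS => le_ts.
apply/map_f/seqs_leP.
  apply: leq_trans le_ts; elim: ts => //= -[us] ts le_ts /=.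
  by rewrite addSn ltnS (leq_trans le_ts) ?leq_addl.
move=> t t_ts; apply: IH; apply: leq_trans le_ts.
elim: ts t_ts => //= u ts IHts; rewrite inE => /orP[/eqP-> | /IHts le_t].
  exact: leq_addr.
by rewrite (leq_trans le_t) ?leq_addl.
Qed.

Definition plane_tree_of (n : nat) := {t : plane_tree | nodes t == n.+1}.

HB.instance Definition _ n := Countable.on (plane_tree_of n).

Lemma plane_tree_of_enumP n :
  Finite.axiom
    (pmap insub (undup (plane_tree_enum n.+1)) : seq (plane_tree_of n)).
Proof.
by apply: insub_enumP => t /eqP eq_t; apply: plane_tree_enumP; rewrite eq_t.
Qed.

HB.instance Definition _ n :=
  isFinite.Build (plane_tree_of n) (@plane_tree_of_enumP n).

Definition plane_tree_count (k n : nat) : nat :=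
  #|[set t : plane_tree_of n | degrees_le k (val t)]|.

Definition modular_catalan (k n : nat) : nat :=
  #|equivalence_partition
      (fun s t : bintree_of n => `[< krot_equiv k (val s) (val t) >])
      [set: bintree_of n]|.

(* Main.v *)
(* A plane tree is determined by the word of its degrees in preorder. Let
   T(m, n) be the number of words of forests of m trees with n nodes and degrees
   less than k, and P = 1 + X + ... + X^(k-1). Removing the first root gives
   T(m+1, n+1) = sum_(d < k) T(m+d, n), from which
   n T(m, n) = m [X^n] X^m P^n follows by induction, using the derivative of
   X^m P^(n+1). The coefficients of P^n come from (1-X)^n P^n = (1-X^k)^n. This
   gives the first formula, with m = 1.

   Cutting a binary tree along its left combs turns it into a plane tree, and a
   k-rotation into the transfer of k children from one node to another, so the
   degree word modulo k is an invariant. Hence every class contains exactly one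
   tree whose non-root nodes have degree less than k, and there are
   sum_m T(m, n) of these. *)
From Stdlib Require Import Relation_Operators.
Require Import Defs.
From mathcomp Require Import all_boot all_order all_algebra.
From mathcomp Require Import boolp ring zify.
Import GRing.Theory.

Set Implicit Arguments.
Unset Strict Implicit.
Unset Printing Implicit Defensive.

(** * Preorder degree words of plane forests *)

Fixpoint preorder_degrees (t : plane_tree) : seq nat :=
  let: PNode ts := t in size ts :: flatten (map preorder_degrees ts).

Definition forest_degrees (ts : seq plane_tree) : seq nat :=
  flatten (map preorder_degrees ts).

Definition forest_nodes (ts : seq plane_tree) : nat := sumn (map nodes ts).

Lemma forest_degrees_cat ts us :
  forest_degrees (ts ++ us) = forest_degrees ts ++ forest_degrees us.
Proof. by rewrite /forest_degrees map_cat flatten_cat. Qed.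

Lemma forest_nodes_cat ts us :
  forest_nodes (ts ++ us) = forest_nodes ts + forest_nodes us.
Proof. by rewrite /forest_nodes map_cat sumn_cat. Qed.

Lemma forest_degrees_cons us ts :
  forest_degrees (PNode us :: ts) = size us :: forest_degrees (us ++ ts).
Proof. by rewrite forest_degrees_cat. Qed.

Lemma forest_nodes_cons us ts :
  forest_nodes (PNode us :: ts) = (forest_nodes (us ++ ts)).+1.
Proof. by rewrite forest_nodes_cat. Qed.

(** Replacing the first tree by its children deletes the first letter of the word; that letter also
    tells where to cut the merged list again, so induction on the word applies. *)
Lemma forest_degrees_inj ts us :
  size ts = size us -> forest_degrees ts = forest_degrees us -> ts = us.
Proof.
move En: (forest_degrees ts) => w.
elim: w ts us En => [|d w IH] [|[ts1] ts] [|[us1] us] //.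
rewrite !forest_degrees_cons => -[<- Ew] [Es] [Ed Ew'].
have sz : size (ts1 ++ ts) = size (us1 ++ us) by rewrite !size_cat Ed Es.
by move/eqP: (IH _ _ Ew sz Ew'); rewrite eqseq_cat // => /andP[/eqP-> /eqP->].
Qed.

Lemma preorder_degrees_inj : injective preorder_degrees.
Proof.
move=> t u E.
by have [] : [:: t] = [:: u]
  by apply: forest_degrees_inj => //; rewrite /forest_degrees /= E.
Qed.

Lemma size_forest_degrees ts : size (forest_degrees ts) = forest_nodes ts.
Proof.
move En: (forest_nodes ts) => n.
elim: n ts En => [|n IH] [|[us] ts] //.
by rewrite forest_nodes_cons forest_degrees_cons /= => -[/IH->].
Qed.

Lemma size_preorder_degrees t : size (preorder_degrees t) = nodes t.
Proof.
by case: t => ts /=; rewrite -[RHS]/(forest_nodes ts).+1 -size_forest_degrees.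
Qed.

(** Every node is either a root or a child of exactly one node. *)
Lemma sumn_forest_degrees ts :
  sumn (forest_degrees ts) + size ts = forest_nodes ts.
Proof.
move En: (forest_nodes ts) => n.
elim: n ts En => [|n IH] [|[us] ts] //.
rewrite forest_nodes_cons forest_degrees_cons /= => -[/IH].
by rewrite size_cat addnS addnCA addnA => <-; congr _.+1; lia.
Qed.

Lemma all_forest_degrees K ts :
  all (degrees_le K) ts -> all (fun d => d <= K) (forest_degrees ts).
Proof.
move En: (forest_nodes ts) => n.
elim: n ts En => [|n IH] [|[us] ts] //.
rewrite forest_nodes_cons forest_degrees_cons /= => -[/IH {}IH].
by rewrite -andbA => /andP[-> /=]; rewrite -all_cat.
Qed.

(* The preorder degree words of the forests of [m] trees with [n] nodes. *)
Fixpoint forest_words (K n m : nat) : seq (seq nat) :=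
  match n, m with
  | 0, 0 => [:: [::]]
  | n'.+1, m'.+1 =>
      [seq d :: w | d <- iota 0 K.+1, w <- forest_words K n' (m' + d)]
  | _, _ => [::]
  end.

Lemma forest_wordsS K n m :
  forest_words K n.+1 m.+1 =
  [seq d :: w | d <- iota 0 K.+1, w <- forest_words K n (m + d)].
Proof. by []. Qed.

Lemma forest_words_uniq K n m : uniq (forest_words K n m).
Proof.
elim: n m => [|n IH] [|m] //; rewrite forest_wordsS.
by apply: allpairs_uniq_dep => [|d _|[d w] [d' w'] _ _ /= [-> ->]] //;
  rewrite ?iota_uniq.
Qed.

Lemma size_forest_words K n m :
  size (forest_words K n.+1 m.+1) =
  \sum_(d < K.+1) size (forest_words K n (m + d)).
Proof.
rewrite forest_wordsS size_allpairs_dep.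
rewrite sumnE big_map.
rewrite -(big_mkord xpredT (fun d => size (forest_words K n (m + d)))).
by rewrite /index_iota subn0.
Qed.

Lemma mem_forest_words K ts :
  all (degrees_le K) ts ->
  forest_degrees ts \in forest_words K (forest_nodes ts) (size ts).
Proof.
move En: (forest_nodes ts) => n.
elim: n ts En => [|n IH] [|[us] ts] //.
rewrite forest_nodes_cons forest_degrees_cons => -[/IH {}IH].
rewrite -cat1s all_cat all_seq1 [degrees_le _ _]/= -andbA => /andP[le_us].
rewrite -all_cat => /IH w_in; rewrite forest_wordsS; apply/allpairsPdep.
exists (size us), (forest_degrees (us ++ ts)).
by split=> //; rewrite ?mem_iota // addnC -size_cat.
Qed.

(** The first letter [d] turns the first [d] trees of the forest built for the tail into the
    children of a new root. *)
Lemma forest_wordsP K n m w :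
  w \in forest_words K n m ->
  exists2 ts, all (degrees_le K) ts &
    [/\ size ts = m, forest_nodes ts = n & forest_degrees ts = w].
Proof.
elim: n m w => [|n IH] [|m] w //.
  by rewrite inE => /eqP->; exists [::].
rewrite forest_wordsS.
case/allpairsPdep=> d [w' [/[!mem_iota] /andP[_ le_d] /IH[ts ts_le]]].
case=> [sz_ts n_ts w_ts] ->.
have sz_d : size (take d ts) = d by rewrite size_take sz_ts; case: ltnP; lia.
exists (PNode (take d ts) :: drop d ts).
  by rewrite /= sz_d -andbA -all_cat cat_take_drop ts_le andbT.
rewrite forest_nodes_cons forest_degrees_cons cat_take_drop n_ts w_ts sz_d.
by rewrite /= size_drop sz_ts addnK.
Qed.

(** * Counting trees through their words *)

Lemma card_of_words (T : finType) (A : {set T}) (f : T -> seq nat) ws :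
  injective f -> uniq ws ->
  (forall t, t \in A -> f t \in ws) ->
  (forall w, w \in ws -> exists2 t, t \in A & f t = w) ->
  #|A| = size ws.
Proof.
move=> f_inj ws_uniq fA wsA; rewrite cardE -(size_map f).
apply/perm_size/uniq_perm => //; first by rewrite map_inj_uniq ?enum_uniq.
move=> w; apply/mapP/idP => [[t /[!mem_enum] tA ->]|/wsA[t tA <-]].
  exact: fA.
by exists t; rewrite ?mem_enum.
Qed.

Lemma plane_tree_countE K n :
  plane_tree_count K n = size (forest_words K n.+1 1).
Proof.
apply: (card_of_words
  (f := fun t : plane_tree_of n => preorder_degrees (val t))).
- by move=> t u /preorder_degrees_inj/val_inj.
- exact: forest_words_uniq.
- move=> [t /= /eqP nt] /[!inE] /= t_le.
  have := @mem_forest_words K [:: t].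
  by rewrite /= t_le /forest_nodes /forest_degrees /= nt addn0 cats0; apply.
- move=> w /forest_wordsP[ts + [sz_ts]].
  case: ts sz_ts => [|t [|u ts]] // _.
  rewrite all_seq1 /forest_nodes /forest_degrees /= addn0 cats0.
  move=> t_le /eqP nt <-.
  by exists (Sub t nt : plane_tree_of n); rewrite ?inE /=.
Qed.

(** * Binary trees as plane trees *)

(** The children of the root come from the right subtrees along the leftmost branch, read from
    bottom to top. *)
Fixpoint plane_of (t : bintree) : plane_tree :=
  if t is BNode l r then
    let: PNode ts := plane_of l in PNode (rcons ts (plane_of r))
  else PNode [::].

Fixpoint bin_of (t : plane_tree) : bintree :=
  let: PNode ts := t in foldl BNode BLeaf (map bin_of ts).

Lemma bin_of_rcons ts t :
  bin_of (PNode (rcons ts t)) = BNode (bin_of (PNode ts)) (bin_of t).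
Proof. by rewrite /= map_rcons foldl_rcons. Qed.

Lemma bin_of_cat ts us :
  bin_of (PNode (ts ++ us)) = comb (bin_of (PNode ts)) (map bin_of us).
Proof. by rewrite /= map_cat /comb foldl_cat. Qed.

Lemma plane_ofK : cancel plane_of bin_of.
Proof.
elim=> [|l IHl r IHr] //=; case: (plane_of l) IHl => ts IHl.
by rewrite bin_of_rcons IHl IHr.
Qed.

Lemma bin_ofK : cancel bin_of plane_of.
Proof.
rewrite /cancel; fix IH 1; case=> ts.
(* The induction hypothesis is gathered for all children at once, so that their list can then be
   taken apart from the right. *)
have {IH}: all (fun t => plane_of (bin_of t) == t) ts.
  by elim: ts => //= t ts ->; rewrite IH eqxx.
elim/last_ind: ts => // ts t IHts; rewrite all_rcons bin_of_rcons.
by case/andP=> /eqP Et /IHts /= ->; rewrite Et.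
Qed.

Lemma nodes_plane_of t : nodes (plane_of t) = leaves t.
Proof.
elim: t => //= l <- r <-; case: (plane_of l) => ts.
by rewrite /= map_rcons sumn_rcons.
Qed.

(** * Degree words of binary trees and their invariance under rotation *)

Definition bin_degrees t := preorder_degrees (plane_of t).

Definition add_head m (w : seq nat) :=
  if w is d :: w' then m + d :: w' else [::].

Lemma bin_degrees_node l r :
  bin_degrees (BNode l r) = add_head 1 (bin_degrees l) ++ bin_degrees r.
Proof.
rewrite /bin_degrees /=; case: (plane_of l) => ts /=.
by rewrite size_rcons map_rcons flatten_rcons.
Qed.

Lemma bin_degrees_neq0 t : bin_degrees t != [::].
Proof. by rewrite /bin_degrees; case: plane_of. Qed.

Lemma bin_degrees_comb t ts :
  bin_degrees (comb t ts) =
  add_head (size ts) (bin_degrees t) ++ flatten (map bin_degrees ts).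
Proof.
elim: ts t => [|u ts IH] t /=.
  by rewrite cats0; case: bin_degrees.
rewrite [LHS]IH bin_degrees_node.
case: (bin_degrees t) (bin_degrees_neq0 t) => //= d w _.
by rewrite addnA addn1 catA.
Qed.

(** A rotation keeps the preorder and only moves [k] units from the first letter contributed by [t0]
    to the first letter contributed by [t1]. *)
Lemma krotation_bin_degrees k s t : krotation k s t ->
  map (modn^~ k) (bin_degrees s) = map (modn^~ k) (bin_degrees t).
Proof.
elim=> {s t} [t0 t1 ts u Ek|s s' t _ IH|s t t' _ IH].
- rewrite !bin_degrees_node !bin_degrees_comb.
  case: (bin_degrees t0) (bin_degrees_neq0 t0) => //= d w _.
  case: (bin_degrees t1) (bin_degrees_neq0 t1) => //= d1 w1 _.
  rewrite size_rcons map_rcons flatten_rcons -Ek /=.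
  by rewrite !map_cat /= !map_cat -!catA /= -!catA addnCA modnDl modnDl.
- rewrite !bin_degrees_node !map_cat; congr (_ ++ _).
  move: IH; case: (bin_degrees s) => [|d w];
    case: (bin_degrees s') => //= d' w'.
  by case=> Ed ->; rewrite -modnDmr Ed modnDmr.
- by rewrite !bin_degrees_node !map_cat IH.
Qed.

Lemma krot_equiv_bin_degrees k s t : krot_equiv k s t ->
  map (modn^~ k) (bin_degrees s) = map (modn^~ k) (bin_degrees t).
Proof.
elim=> {s t} [s t /krotation_bin_degrees|s|s t _ ->|s t u _ -> _ ->] //.
Qed.

(** * Normal forms under rotation *)

Lemma krot_equiv_nodel k s s' t :
  krot_equiv k s s' -> krot_equiv k (BNode s t) (BNode s' t).
Proof.
elim=> {s s'} [s s' ss'|s|s s' _ IH|s s' s'' _ IH _ IH'].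
- exact/rst_step/krot_left.
- exact: rst_refl.
- exact: rst_sym.
- exact: rst_trans IH IH'.
Qed.

Lemma krot_equiv_noder k s t t' :
  krot_equiv k t t' -> krot_equiv k (BNode s t) (BNode s t').
Proof.
elim=> {t t'} [t t' tt'|t|t t' _ IH|t t' t'' _ IH _ IH'].
- exact/rst_step/krot_right.
- exact: rst_refl.
- exact: rst_sym.
- exact: rst_trans IH IH'.
Qed.

Lemma krot_equiv_comb k s s' ts :
  krot_equiv k s s' -> krot_equiv k (comb s ts) (comb s' ts).
Proof. by elim: ts s s' => //= t ts IH s s' ss'; apply/IH/krot_equiv_nodel. Qed.

(* Right-to-left rotations split off blocks of K+1 children of the right
   subtree until its degree is at most K. *)
Lemma krot_normal_node K us vs :
  all (degrees_le K) us -> all (degrees_le K) vs ->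
  exists2 ws, all (degrees_le K) ws &
    krot_equiv K.+1 (BNode (bin_of (PNode us)) (bin_of (PNode vs)))
      (bin_of (PNode ws)).
Proof.
move En: (size vs) => n; elim/ltn_ind: n vs En => n IH vs En us_le vs_le.
have [le_nK|lt_Kn] := leqP n K.
  exists (rcons us (PNode vs)); last by rewrite bin_of_rcons; apply: rst_refl.
  by rewrite all_rcons us_le /= En le_nK vs_le.
(* The last [K.+1] children, [rcons ts u], are handed over to the root; the induction continues with
   the shorter list [vs1]. *)
have [vs1 [ts [u [Evs sz_ts]]]] :
    exists vs1 ts u, vs = vs1 ++ rcons ts u /\ size ts = K.
  exists (take (n - K.+1) vs).
  have: size (drop (n - K.+1) vs) = K.+1 by rewrite size_drop En subKn.
  case/lastP E: (drop _ _) => [|ts u] //; rewrite size_rcons => -[sz_ts].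
  by exists ts, u; rewrite -E cat_take_drop.
move: vs_le; rewrite Evs all_cat => /andP[vs1_le ts_le].
have lt_vs1 : size vs1 < n by rewrite -En Evs size_cat size_rcons; lia.
have [ws ws_le ws_eq] := IH _ lt_vs1 vs1 erefl us_le vs1_le.
exists (ws ++ rcons ts u); first by rewrite all_cat ws_le.
rewrite !bin_of_cat.
apply: rst_trans (krot_equiv_comb (map bin_of (rcons ts u)) ws_eq).
apply: rst_sym; apply: rst_step; rewrite map_rcons.
rewrite [X in krotation _ X _]/comb foldl_rcons -/(comb _ _).
by apply: (@krot_root _ _ _ (map bin_of ts)); rewrite /= size_map sz_ts.
Qed.

(** The degree of the root stays free, since normalization moves excess degree towards the root. *)
Definition krot_normal K t :=
  let: PNode ts := plane_of t in all (degrees_le K) ts.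

Lemma krot_normal_exists K t :
  exists2 s, krot_normal K s & krot_equiv K.+1 t s.
Proof.
suff [ws ws_le eq_ws] : exists2 ws, all (degrees_le K) ws &
    krot_equiv K.+1 t (bin_of (PNode ws)).
  by exists (bin_of (PNode ws)) => //; rewrite /krot_normal bin_ofK.
elim: t => [|l [us us_le eq_us] r [vs vs_le eq_vs]].
  by exists [::] => //; apply: rst_refl.
have [ws ws_le eq_ws] := krot_normal_node us_le vs_le.
exists ws => //; apply: rst_trans eq_ws.
apply: rst_trans (krot_equiv_nodel _ eq_us) _.
exact: krot_equiv_noder.
Qed.

Lemma map_modn_small k w : all (fun d => d < k) w -> map (modn^~ k) w = w.
Proof. by elim: w => //= d w IH /andP[lt_d /IH->]; rewrite modn_small. Qed.

(* Only the degree of the root is not determined by its residue; it is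
   determined by the others because the degrees add up to one less than the
   number of nodes. *)
Lemma krot_normal_unique K s t :
  krot_normal K s -> krot_normal K t -> krot_equiv K.+1 s t -> s = t.
Proof.
rewrite /krot_normal => s_le t_le /krot_equiv_bin_degrees E.
apply: (can_inj plane_ofK); move: E s_le t_le; rewrite /bin_degrees.
case: (plane_of s) => us; case: (plane_of t) => vs [_].
rewrite -!/(forest_degrees _) => E /all_forest_degrees us_le
  /all_forest_degrees vs_le.
have {}E : forest_degrees us = forest_degrees vs.
  rewrite -(@map_modn_small K.+1 (forest_degrees us)) // E.
  exact: map_modn_small.
congr PNode; apply: forest_degrees_inj => //.
have := sumn_forest_degrees us; have := sumn_forest_degrees vs.
by rewrite -!size_forest_degrees E; lia.
Qed.

(** * Counting the classes *)

Lemma krot_equiv_leaves k s t : krot_equiv k s t -> leaves s = leaves t.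
Proof.
move/krot_equiv_bin_degrees/(congr1 size).
by rewrite !size_map /bin_degrees !size_preorder_degrees !nodes_plane_of.
Qed.

(** Sending a normal tree to its class is onto by [krot_normal_exists] and injective by
    [krot_normal_unique]. *)
Lemma modular_catalan_normal K n :
  modular_catalan K.+1 n =
  #|[set t : bintree_of n | krot_normal K (val t)]|.
Proof.
set R := fun s t : bintree_of n => `[< krot_equiv K.+1 (val s) (val t) >].
set N := [set t | _]; pose f s := [set t in [set: bintree_of n] | R s t].
rewrite /modular_catalan -/R -[RHS](@card_in_imset _ _ f); last first.
  move=> s t /[!inE] sN tN /setP/(_ t); rewrite !inE /R.
  rewrite [RHS](asboolT (rst_refl _ _ _)) => /asboolP st.
  exact/val_inj/(krot_normal_unique sN tN st).
congr #|pred_of_set _|; apply/setP=> A; apply/imsetP/imsetP => -[s sD EA].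
  have [t tN st] := krot_normal_exists K (val s).
  have lt : leaves t == n.+1.
    by rewrite -(krot_equiv_leaves st); exact: (valP s).
  exists (Sub t lt : bintree_of n); first by rewrite inE /=.
  rewrite EA; apply/setP=> u; rewrite !inE /R /=; apply/asboolP/asboolP.
    exact/rst_trans/rst_sym.
  exact: rst_trans.
by exists s.
Qed.

(** Here [m] is the root degree of the plane tree of a normal tree; deleting that root leaves a
    forest of [m] trees with [n] nodes. *)
Lemma modular_catalanE K n :
  modular_catalan K.+1 n = \sum_(m < n.+1) size (forest_words K n m).
Proof.
rewrite modular_catalan_normal.
transitivity (size [seq m :: w | m <- iota 0 n.+1, w <- forest_words K n m]);
  last first.
  rewrite size_allpairs_dep sumnE big_map.
  rewrite -(big_mkord xpredT (fun m => size (forest_words K n m))).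
  by rewrite /index_iota subn0.
apply: (card_of_words (f := fun t : bintree_of n => bin_degrees (val t))).
- by move=> s t /preorder_degrees_inj/(can_inj plane_ofK)/val_inj.
- apply: allpairs_uniq_dep => [|m _|[m w] [m' w'] _ _ /= [-> ->]] //.
    exact: iota_uniq.
  exact: forest_words_uniq.
- move=> t; rewrite inE /krot_normal /bin_degrees; have /eqP := valP t.
  rewrite -nodes_plane_of; case: (plane_of (val t)) => ts [nts] ts_le.
  apply/allpairsPdep; exists (size ts), (forest_degrees ts); split=> //.
    rewrite mem_iota /= add0n ltnS -nts -/(forest_nodes ts).
    by rewrite -sumn_forest_degrees leq_addl.
  by rewrite -nts; apply: mem_forest_words.
- move=> w /allpairsPdep[m [w' [_ /forest_wordsP[ts ts_le [sz nts <-]] ->]]].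
  have lt : leaves (bin_of (PNode ts)) == n.+1.
    by rewrite -nodes_plane_of bin_ofK /= -/(forest_nodes ts) nts.
  exists (Sub (bin_of (PNode ts)) lt : bintree_of n).
    by rewrite inE SubK /krot_normal bin_ofK.
  by rewrite SubK /bin_degrees bin_ofK /= sz.
Qed.

(** * Binomial identities for compositions *)

Local Open Scope ring_scope.

(* The number of ways to write [s] as an ordered sum of [n] naturals; for
   [n = 0] the truncated subtraction makes it 1 at [s = 0] and 0 elsewhere. *)
Definition compositions (n s : nat) : nat := 'C(s + n - 1, s).

Lemma compositionsS n s :
  compositions n.+1 s.+1 = (compositions n.+1 s + compositions n s.+1)%N.
Proof.
rewrite /compositions; case: n => [|n].
  by rewrite addn0 !addn1 !subn1 /= !binn bin_small.
by rewrite !addnS !addSn !subn1 /= binS addnC.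
Qed.

Lemma compositions0r n : compositions n 0 = 1%N.
Proof. by rewrite /compositions bin0. Qed.

Lemma sum_compositions n s :
  (\sum_(i < s.+1) compositions n i)%N = compositions n.+1 s.
Proof.
elim: s => [|s IH]; first by rewrite big_ord1 !compositions0r.
by rewrite big_ord_recr /= IH compositionsS.
Qed.

(** Both sides are the coefficient of degree [s] in [X/(1-X)^2 * 1/(1-X)^n = X/(1-X)^(n+2)]. *)
Lemma sum_mul_compositions n s : (0 < n)%N ->
  (\sum_(m < s.+1) m * compositions n (s - m))%N = 'C(s + n, n.+1).
Proof.
move=> n_gt0; elim: s => [|s IH]; first by rewrite big_ord1 bin_small.
rewrite big_ord_recl mul0n add0n.
under eq_bigr => i _ do rewrite lift0 subSS mulSn.
rewrite big_split /= IH (reindex_inj rev_ord_inj) /=.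
under eq_bigr => i _ do rewrite subSS subKn ?(leq_ord i) //.
rewrite sum_compositions /compositions addSn binS addnC; congr (_ + _)%N.
by rewrite addnS subn1 /= -bin_sub ?leq_addr // addKn.
Qed.

(** * Coefficients of powers of a geometric sum *)

Section Geometric.

Variable R : comNzRingType.

(** The power series [(1-X)^(-n)] truncated below degree [N]. *)
Definition compositions_poly (N n : nat) : {poly R} :=
  \poly_(i < N) (compositions n i)%:R.

(** Below degree [N] this is the recurrence [compositionsS]; the truncation leaves a single term at
    degree [N]. *)
Lemma compositions_polyS N n : exists c : R,
  (1 - 'X) * compositions_poly N n.+1 = compositions_poly N n + c *: 'X^N.
Proof.
case: N => [|N].
  exists 0; rewrite /compositions_poly !poly_def !big_ord0.
  by rewrite mulr0 scale0r addr0.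
exists (- (compositions n.+1 N)%:R); apply/polyP=> i.
rewrite mulrBl mul1r coefB coefXM coefD coefZ coefXn !coef_poly.
case: i => [|i] /=; first by rewrite !compositions0r mulr0 subr0 addr0.
rewrite ltnS eqSS.
have [lt_iN|lt_Ni|->] := ltngtP i N.
- by rewrite ltnS (ltnW lt_iN) compositionsS natrD addrC addKr mulr0 addr0.
- by rewrite ltnS leqNgt lt_Ni mulr0 !subr0 addr0.
- by rewrite leqnn mulr1.
Qed.

Lemma exp_compositions_poly N n : (0 < N)%N -> exists q : {poly R},
  (1 - 'X) ^+ n * compositions_poly N n = 1 + 'X^N * q.
Proof.
move=> N_gt0; elim: n => [|n [q Eq]].
  exists 0; rewrite mulr0 addr0 mul1r; apply/polyP=> i.
  rewrite coef_poly coef1 /compositions addn0.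
  case: i => [|i] /=; first by rewrite N_gt0 bin0.
  by rewrite subn1 /= bin_small // if_same.
have [c Ec] := compositions_polyS N n.
exists (q + c *: (1 - 'X) ^+ n).
rewrite exprSr -mulrA Ec mulrDr Eq mulrDr addrA; congr (_ + _).
by rewrite -scalerAr mulrC scalerAr.
Qed.

Definition geom_poly (k : nat) : {poly R} := \poly_(i < k) 1.

Lemma geom_polyE k : geom_poly k = \sum_(i < k) 'X^i.
Proof.
by rewrite /geom_poly poly_def; apply: eq_bigr => i _; rewrite scale1r.
Qed.

Lemma mul_geom_poly k : (1 - 'X) * geom_poly k = 1 - 'X^k.
Proof.
by rewrite geom_polyE -[1 - 'X^k]opprB subrX1 -mulNr opprB.
Qed.

(** Modulo [X^(s+1)], [compositions_poly s.+1 n] inverts [(1-X)^n], so the power of [geom_poly k]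
    may be replaced by [(1-X^k)^n] times this inverse and expanded by the binomial theorem. *)
Lemma coef_geom_polyX k n s :
  (geom_poly k ^+ n)`_s =
  \sum_(j < n.+1 | (j * k <= s)%N)
     (-1) ^+ j * 'C(n, j)%:R * (compositions n (s - j * k))%:R.
Proof.
have [q Eq] := @exp_compositions_poly s.+1 n isT.
have -> : (geom_poly k ^+ n)`_s =
          ((1 - 'X^k) ^+ n * compositions_poly s.+1 n)`_s.
  rewrite -mul_geom_poly exprMn mulrAC Eq mulrDl mul1r coefD -mulrA coefXnM.
  by rewrite ltnSn addr0.
rewrite exprBn mulr_suml coef_sum [RHS]big_mkcond; apply: eq_bigr => j _ /=.
rewrite expr1n mulr1 -exprM -mulrnAl.
rewrite -[(-1) ^+ j *+ _]mulr_natr -polyC1 -polyCN -polyC_exp -polyC_natr.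
rewrite -polyCM -(mulrA _%:P) coefCM coefXnM coef_poly mulnC ltnS leq_subr.
by rewrite ltnNge; case: leqP => _ //=; rewrite mulr0.
Qed.

(* Both sides are the coefficient of degree [n] in
   ['X * ('X^m * geom_poly k ^+ n.+1)^`()]. *)
Lemma sum_coef_geom_polyX k m n :
  n.+1%:R * (\sum_(d < k) d%:R * ('X^(m + d) * geom_poly k ^+ n)`_n)
    + m%:R * ('X^m * geom_poly k ^+ n.+1)`_n
  = n%:R * ('X^m * geom_poly k ^+ n.+1)`_n.
Proof.
have dP : 'X * (geom_poly k)^`() = \sum_(d < k) (d%:R : R) *: 'X^d.
  rewrite geom_polyE raddf_sum mulr_sumr; apply: eq_bigr => -[[|d] ?] _ /=.
    by rewrite derivXn /= mulr0n mulr0 scale0r.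
  by rewrite derivXn /= mulrnAr -exprS scaler_nat.
have coefXd (p : {poly R}) : ('X * p^`())`_n = n%:R * p`_n.
  rewrite coefXM coef_deriv.
  by case: n => [|n'] /=; rewrite ?mul0r // mulr_natl.
rewrite -coefXd derivM derivXn mulrDr coefD addrC; congr (_ + _).
  rewrite mulrA; case: (m) => [|m'] /=.
    by rewrite mul0r mulr0n mulr0 mul0r coef0.
  by rewrite mulr_natl mulrnAr -exprS mulrnAl coefMn.
rewrite deriv_exp /= mulrCA.
rewrite (_ : _ * _ = n.+1%:R *
  \sum_(d < k) (d%:R : R) *: ('X^(m + d) * geom_poly k ^+ n)).
  rewrite -polyC_natr coefCM coef_sum; congr (_ * _); apply: eq_bigr => d _.
  by rewrite coefZ.
transitivity (n.+1%:R * ('X^m * ('X * (geom_poly k)^`()) * geom_poly k ^+ n)).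
  by ring.
rewrite dP mulr_sumr mulr_suml; congr (_ * _); apply: eq_bigr => d _.
by rewrite -scalerAr -scalerAl exprD.
Qed.

End Geometric.

(** * The number of forests and the two formulas *)

(** The factor [n] is kept on the left so that the identity also makes sense for [n = 0]. *)
Lemma size_forest_wordsE K n m :
  n%:R * (size (forest_words K n m))%:R =
  m%:R * ('X^m * geom_poly rat K.+1 ^+ n)`_n.
Proof.
elim: n m => [|n IH] [|m]; rewrite ?mul0r ?mulr0 //.
  by rewrite mulr1 coefXn mulr0.
rewrite exprS -(mulrA 'X) coefXM /=; set c := _`_n.
have Ec : c = \sum_(d < K.+1) ('X^(m + d) * geom_poly rat K.+1 ^+ n)`_n.
  rewrite /c exprS mulrA {1}geom_polyE mulr_sumr mulr_suml coef_sum.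
  by apply: eq_bigr => d _; rewrite exprD.
rewrite size_forest_words natr_sum.
(* The induction hypothesis determines the counts only for nonzero [n]; the passage from 0 to 1 is
   computed directly below. *)
have [n0|n_neq0] := eqVneq (n%:R : rat) 0; last first.
  apply: (mulfI n_neq0).
  (* The factor [m + d] from the induction hypothesis is split: the [m] part sums to [c], and the
     [d] part is evaluated by [sum_coef_geom_polyX]. *)
  have -> :
    n%:R * (n.+1%:R * \sum_(d < K.+1) (size (forest_words K n (m + d)))%:R)
    = n.+1%:R * (m%:R * c) + n.+1%:R *
      \sum_(d < K.+1) d%:R * ('X^(m + d) * geom_poly rat K.+1 ^+ n)`_n.
    rewrite mulrCA -mulrDr; congr (_ * _); rewrite Ec !mulr_sumr -big_split /=.
    by apply: eq_bigr => d _; rewrite IH natrD mulrDl.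
  have := sum_coef_geom_polyX rat K.+1 m n; rewrite -/c.
  set S := \sum_(d < _) _ => ES.
  have {}ES : n.+1%:R * S = n%:R * c - m%:R * c by rewrite -ES addrK.
  by rewrite ES -!natr1; ring.
have {}n0 : n = 0%N by apply/eqP; rewrite -(Num.Theory.pnatr_eq0 rat) n0.
rewrite {}/c n0 in Ec *.
rewrite [X in _ = _ * X]Ec !mulr_sumr; apply: eq_bigr => d _.
rewrite mulr1 coefXn; case: m {IH Ec} => [|m] /=.
  by case: (nat_of_ord d).
by rewrite !mulr0.
Qed.

Theorem theorem4p8 :
  (forall k n : nat, (1 <= k)%N ->
     (plane_tree_count (k - 1) n)%:R =
       (n + 1)%:R^-1 *
         \sum_(0 <= j < (n %/ k).+1)
           (-1) ^+ j * 'C(n + 1, j)%:R * 'C(2 * n - j * k, n)%:R :> rat)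
  /\
  (forall k n : nat, (1 <= k)%N -> (1 <= n)%N ->
     (modular_catalan k n)%:R =
       \sum_(0 <= j < ((n - 1) %/ k).+1)
         (-1) ^+ j / n%:R * 'C(n, j)%:R * 'C(2 * n - j * k, n + 1)%:R :> rat).
Proof.
split=> [] [//|K] n _ => [|n_gt0].
  rewrite subn1 addn1 plane_tree_countE.
  have n_neq0 : n.+1%:R != 0 :> rat by rewrite Num.Theory.pnatr_eq0.
  apply: (mulfI n_neq0); rewrite mulVKf // size_forest_wordsE mul1r expr1.
  rewrite coefXM coef_geom_polyX big_mkord.
  (* Both sums now run over [j < n.+2], and their conditions agree because [j <= n %/ K.+1] means
     [j * K.+1 <= n]. *)
  rewrite (big_ord_widen_cond n.+2 xpredT (fun j => (-1) ^+ j * 'C(n.+1, j)%:R *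
    'C(2 * n - j * K.+1, n)%:R)); last by rewrite ltnS ltnW // ltnS leq_div.
  apply: eq_big => j; first by rewrite ltnS leq_divRL.
  move=> le_jn; congr (_ * _%:R); rewrite /compositions.
  rewrite -bin_sub; last by lia.
  by congr 'C(_, _); lia.
have n_neq0 : n%:R != 0 :> rat by rewrite Num.Theory.pnatr_eq0 -lt0n.
apply: (mulfI n_neq0); rewrite modular_catalanE natr_sum !mulr_sumr.
under eq_bigr => m _ do
  rewrite size_forest_wordsE coefXnM ltnNge leq_ord coef_geom_polyX mulr_sumr.
(* With [j] outermost, the inner sum over root degrees [m] can be evaluated by
   [sum_mul_compositions]. *)
rewrite (exchange_big_dep xpredT) //= big_mkord.
rewrite (big_ord_widen n.+1 (fun j => n%:R * ((-1) ^+ j / n%:R * 'C(n, j)%:R *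
    'C(2 * n - j * K.+1, n + 1)%:R) : rat)); last first.
  by rewrite ltnS (leq_trans (leq_div _ _)) // leq_subr.
rewrite [RHS]big_mkcond /=; apply: eq_bigr => j _.
transitivity ((-1) ^+ j * 'C(n, j)%:R *
  (\sum_(m < n.+1 | (j * K.+1 <= n - m)%N)
     m * compositions n (n - m - j * K.+1))%N%:R : rat).
  rewrite natr_sum mulr_sumr; apply: eq_bigr => m _.
  by rewrite natrM mulrCA mulrA.
(* Beyond [n] the inner sum is empty and [j] lies outside the range on the right. *)
have [lt_nj|le_jn] := ltnP n (j * K.+1).
  rewrite big1 => [|m]; last by lia.
  by rewrite mulr0 ltnS leq_divRL // ifF //; lia.
have -> : (\sum_(m < n.+1 | (j * K.+1 <= n - m)%N)
     m * compositions n (n - m - j * K.+1))%N = 'C(2 * n - j * K.+1, n + 1).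
  rewrite (_ : 2 * n - j * K.+1 = n - j * K.+1 + n)%N; last by lia.
  rewrite addn1 -sum_mul_compositions //.
  rewrite (big_ord_widen n.+1
    (fun m => m * compositions n (n - j * K.+1 - m))%N);
    last by rewrite ltnS leq_subr.
  apply: eq_big => m; first by rewrite ltnS leq_subCr ?leq_ord.
  by rewrite subnAC.
case: ifP => [_|]; first by rewrite -!mulrA [RHS]mulrCA mulVKf.
(* What remains is [j * K.+1 = n]: this [j] is missing on the right, and on the left its binomial
   ['C(n, n + 1)] vanishes. *)
rewrite ltnS leq_divRL // => /negbT; rewrite -ltnNge => lt_nj.
by rewrite (@bin_small _ (n + 1)) ?mulr0 //; lia.
Qed.
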